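(* Let $\mathcal{I}=\mathrm{FIN}\times\mathrm{FIN}$ and $\mathbb{P}=\mathcal{I}^{+}$. Then $\mathbb{P}$ forces that the generic ultrafilter $\mathring{\mathcal{U}}$ is not basically generated.
   Context: $\mathrm{FIN}\times\mathrm{FIN}$ is the ideal $\mathcal{I}$ on $\omega\times\omega$ of all $A$ such that for all but finitely many $n$ the section $A(n)=\{m:\langle n,m\rangle\in A\}$ is finite. $\mathbb{P}=\mathcal{I}^{+}$ is the set of $\mathcal{I}$-positive subsets of $\omega\times\omega$ ordered by $q\le p$ iff $q\setminus p\in\mathcal{I}$, and $\mathring{\mathcal{U}}$ is the name for the generic filter, which is an ultrafilter on $\omega\times\omega$. For an ultrafilter $\mathcal{U}$ on a countable set $S$, a set $\mathcal{B}\subset\mathcal{U}$ is a filter base if every $a\in\mathcal{U}$ contains some $b\in\mathcal{B}$ and $\mathcal{B}$ is closed under finite intersections. $\mathcal{U}$ is basically generated if there is a filter base $\mathcal{B}\subset\mathcal{U}$ such that whenever $\langle b_n:n\in\omega\rangle\subset\mathcal{B}$ converges to some $b\in\mathcal{B}$ in the usual (Cantor) topology on $\mathcal{P}(S)$, there is an infinite $X\subset\omega$ with $\bigcap_{n\in X}b_n\in\mathcal{U}$. *)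

(* Defs.v *)
From mathcomp Require Import all_boot.
From mathcomp Require Import boolp classical_sets functions cardinality.

Set Implicit Arguments.
Unset Strict Implicit.
Unset Printing Implicit Defensive.

Local Open Scope classical_set_scope.

Record forcing_notion := ForcingNotion {
  cond :> Type;
  fle : cond -> cond -> Prop;
  fle_refl : forall p, fle p p;
  fle_trans : forall q p r, fle p q -> fle q r -> fle p r }.

Section Forcing.
Variable P : forcing_notion.

(* The ground model is the ambient (classical) universe, and names are kept
   typed.  For a ground-model set S, a P-name for a subset of S is a set of
   pairs <check s, p> with s in S and p in P (only s is recorded). *)
Definition subset_name (S : Type) := set (S * P).

(* A P-name for a set of subsets of S. *)
Definition family_name (S : Type) := set (subset_name S * P).

(* A P-name for a sequence of subsets of S, i.e. for a subset of omega x S,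
   in curried form. *)
Definition seq_name (S : Type) := nat -> subset_name S.

Definition dense_below (p : P) (D : set P) : Prop :=
  forall q, fle q p -> exists2 r, fle r q & D r.

Definition forces_mem (S : Type) (p : P) (s : S) (tau : subset_name S) : Prop :=
  dense_below p [set q | exists r, tau (s, r) /\ fle q r].

Definition forces_eq (S : Type) (p : P) (sigma tau : subset_name S) : Prop :=
  forall s q, fle q p -> (forces_mem q s sigma <-> forces_mem q s tau).

Definition forces_in (S : Type) (p : P) (sigma : subset_name S)
    (B : family_name S) : Prop :=
  dense_below p [set q | exists tau r,
    [/\ B (tau, r), fle q r & forces_eq q sigma tau]].

(* Formulas of the forcing language, in higher-order abstract syntax.  The
   index type A of a quantifier is either a ground-model set (quantification
   over its check name) or one of the types of names above.  [Ground Q] is an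
   absolute statement about check names. *)
Inductive formula : Type :=
| Ground of Prop
| Mem (S : Type) of S & subset_name S
| In (S : Type) of subset_name S & family_name S
| Not of formula
| And of formula & formula
| Imp of formula & formula
| All (A : Type) of (A -> formula)
| Ex (A : Type) of (A -> formula).

Fixpoint forces (p : P) (phi : formula) : Prop :=
  match phi with
  | Ground Q => Q
  | Mem _ s tau => forces_mem p s tau
  | In _ sigma B => forces_in p sigma B
  | Not f => forall q, fle q p -> ~ forces q f
  | And f g => forces p f /\ forces p g
  | Imp f g => forall q, fle q p -> forces q f -> forces q g
  | All A f => forall x : A, forces p (f x)
  | Ex A f => dense_below p [set q | exists x : A, forces q (f x)]
  end.

(* P forces phi: every condition does. *)
Definition forced (phi : formula) : Prop := forall p : P, forces p phi.

Definition Iff (f g : formula) : formula := And (Imp f g) (Imp g f).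

Definition check (S : Type) (A : set S) : subset_name S := [set x | A x.1].

(* The name {<check s, q> : q forces phi(s)} for {s in S : phi(s)}. *)
Definition comprehension (S : Type) (phi : S -> formula) : subset_name S :=
  [set x | forces x.2 (phi x.1)].

Definition cap_name (S : Type) (sigma tau : subset_name S) : subset_name S :=
  comprehension (fun s => And (Mem s sigma) (Mem s tau)).

Definition bigcap_name (S : Type) (X : subset_name nat) (b : seq_name S) :
    subset_name S :=
  comprehension (fun s => All (fun n : nat => Imp (Mem n X) (Mem s (b n)))).

Definition sub_formula (S : Type) (sigma tau : subset_name S) : formula :=
  All (fun s : S => Imp (Mem s sigma) (Mem s tau)).

Definition infinite_formula (X : subset_name nat) : formula :=
  All (fun k : nat => Ex (fun n : nat => And (Ground (k <= n)) (Mem n X))).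

(* Convergence in the Cantor topology of the power set of S: the sets
   {x : x and c agree on F}, F finite, are a neighbourhood base at c. *)
Definition converges_formula (S : countType) (b : seq_name S)
    (c : subset_name S) : formula :=
  All (fun F : seq S => Ex (fun N : nat => All (fun n : nat =>
    Imp (Ground (N <= n)) (All (fun s : S =>
      Imp (Ground (s \in F)) (Iff (Mem s (b n)) (Mem s c))))))).

Definition filter_base_formula (S : Type) (B U : family_name S) : formula :=
  And (All (fun b : subset_name S => Imp (In b B) (In b U)))
  (And (All (fun a : subset_name S => Imp (In a U)
         (Ex (fun b : subset_name S => And (In b B) (sub_formula b a)))))
       (All (fun b : subset_name S => All (fun b' : subset_name S =>
         Imp (And (In b B) (In b' B)) (In (cap_name b b') B))))).

Definition basically_generated (S : countType) (U : family_name S) : formula :=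
  Ex (fun B : family_name S => And (filter_base_formula B U)
    (All (fun b : seq_name S => All (fun c : subset_name S =>
      Imp (And (All (fun n : nat => In (b n) B))
               (And (In c B) (converges_formula b c)))
          (Ex (fun X : subset_name nat =>
             And (infinite_formula X) (In (bigcap_name X b) U))))))).

End Forcing.

Definition FINxFIN : set (set (nat * nat)) :=
  [set A | finite_set [set n | ~ finite_set (xsection A n)]].

Lemma FINxFIN_sub (A B : set (nat * nat)) :
  A `<=` B -> FINxFIN B -> FINxFIN A.
Proof.
move=> AB; apply: sub_finite_set => n /= An Bn; apply: An.
apply: sub_finite_set Bn => m; rewrite /xsection /= !inE; exact: AB.
Qed.

Lemma FINxFIN_setU (A B : set (nat * nat)) :
  FINxFIN A -> FINxFIN B -> FINxFIN (A `|` B).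
Proof.
move=> IA IB; have : finite_set ([set n | ~ finite_set (xsection A n)] `|`
    [set n | ~ finite_set (xsection B n)]) by rewrite finite_setU.
apply: sub_finite_set => n /= ABn; apply: contrapT => /not_orP[/contrapT An].
move=> /contrapT Bn; apply: ABn.
have : finite_set (xsection A n `|` xsection B n) by rewrite finite_setU.
by apply: sub_finite_set => m; rewrite /xsection /= !inE.
Qed.

Definition positive := {p : set (nat * nat) | ~ FINxFIN p}.

Definition positive_le (q p : positive) : Prop :=
  FINxFIN (sval q `\` sval p).

Lemma positive_le_refl (p : positive) : positive_le p p.
Proof.
rewrite /positive_le setDv /FINxFIN /=; apply: sub_finite_set (@finite_set0 _).
by move=> n /=; apply; rewrite xsection0.
Qed.

Lemma positive_le_trans (q p r : positive) :
  positive_le p q -> positive_le q r -> positive_le p r.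
Proof.
move=> pq qr; apply: FINxFIN_sub (FINxFIN_setU pq qr) => x [px rx].
by have [qx|qx] := pselect (sval q x); [right|left].
Qed.

Definition FINxFIN_positive : forcing_notion :=
  ForcingNotion positive_le_refl positive_le_trans.

(* The canonical name {<check p, p> : p in P} for the generic filter. *)
Definition generic_name : family_name FINxFIN_positive (nat * nat) :=
  [set x | x.1 = check (sval x.2)].

(* Main.v *)
(* Suppose a condition forces B to be a base witnessing basic generation.  The
   forcing is countably closed, so only ground-model members of B matter.
   If c is in B, there is no sequence d_i in B such that d_i agrees with c on
   i x i and has finite columns below i: it would converge to c, but an
   intersection of infinitely many d_i has only finite columns.  As B is closed
   under finite intersections, it follows that for some i and k < i every d in B
   with the same trace F on i x i as c has an infinite k-th column: column k is
   locked by (F, i).  The columns locked by (F, i) have pairwise infinite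
   intersections, so of two disjoint halves of a column at most one can almost
   contain such a column.  There are only countably many triples (F, i, k), and
   a fusion produces a condition q none of whose columns almost contains a
   locked one.  A member of B included in q is then a contradiction. *)

Require Import Defs.
From mathcomp Require Import all_boot.
From mathcomp Require Import boolp classical_sets functions cardinality.

Set Implicit Arguments.
Unset Strict Implicit.
Unset Printing Implicit Defensive.

Local Open Scope classical_set_scope.

(** * Infinite sets of natural numbers *)

Lemma finite_set_natP (A : set nat) :
  finite_set A <-> exists N, forall m, A m -> m < N.
Proof.
split=> [/finite_seqP[s ->]|[N AN]].
  exists (\max_(i <- s) i).+1 => m /= ms; rewrite ltnS.
  by apply: (leq_bigmax_seq m).
by apply: sub_finite_set (finite_II N) => m /AN.
Qed.

Lemma infinite_set_nat_ge (A : set nat) :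
  ~ finite_set A -> forall N, exists2 m, N <= m & A m.
Proof.
move=> Ainf N; apply: contrapT => H; apply: Ainf; apply/finite_set_natP.
exists N => m Am; rewrite ltnNge; apply/negP => Nm; apply: H; by exists m.
Qed.

Lemma infinite_range_ge_id (g : nat -> nat) :
  (forall i, i <= g i) -> ~ finite_set (range g).
Proof.
move=> gi /finite_set_natP[N H].
by have := H (g N) (ex_intro2 _ _ N I erefl); rewrite ltnNge gi.
Qed.

Lemma increasing_selection (Q : nat -> set nat) :
  (forall i, ~ finite_set (Q i)) ->
  exists g : nat -> nat, (forall i, Q i (g i)) /\ {homo g : i j / i < j}.
Proof.
move=> Qinf; have [f Hf] : {f : nat * nat -> nat &
    forall x, x.2 <= f x /\ Q x.1 (f x)}.
  apply: (@choice _ _ (fun x m => x.2 <= m /\ Q x.1 m)) => x.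
  by have [m xm Qm] := infinite_set_nat_ge (Qinf x.1) x.2; exists m.
pose g := fix g i := if i is i'.+1 then f (i, (g i').+1) else f (0, 0).
exists g; split=> [[|i]|]; [exact: (Hf (0, 0)).2|exact: (Hf (_, _)).2|].
apply: homo_ltn => [? ? ?|i]; first exact: ltn_trans.
exact: (Hf (i.+1, (g i).+1)).1.
Qed.

Lemma homo_ltn_ge (g : nat -> nat) :
  {homo g : i j / i < j} -> forall i, i <= g i.
Proof. by move=> hg; elim=> // i IH; apply: leq_ltn_trans IH (hg _ _ _). Qed.

(** The even and the odd terms of an increasing sequence in [Q] form the two halves. Infinity is
    conditional so that finite columns are covered too. *)
Lemma infinite_set_split (Q : set nat) : exists A A' : set nat,
  [/\ A `<=` Q, A' `<=` Q, A `&` A' = set0,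
      ~ finite_set Q -> ~ finite_set A & ~ finite_set Q -> ~ finite_set A'].
Proof.
have [Qfin|Qinf] := pselect (finite_set Q).
  by exists set0, set0; split=> //; rewrite setI0.
have [g [gQ hg]] := @increasing_selection (fun=> Q) (fun=> Qinf).
have g_ge := homo_ltn_ge hg.
exists (range (fun i => g i.*2)), (range (fun i => g i.*2.+1)); split.
- by move=> _ [i _ <-].
- by move=> _ [i _ <-].
- apply/seteqP; split=> // _ [[i _ <-] [j _ E]].
  have gi : injective g.
    move=> a b gab; case: (ltngtP a b) => // /hg; by rewrite gab ltnn.
  by move/gi/(congr1 odd): E; rewrite /= !odd_double.
- move=> _; apply: infinite_range_ge_id => i; apply: leq_trans (g_ge _).
  by rewrite -addnn leq_addr.
- move=> _; apply: infinite_range_ge_id => i; apply: leq_trans (g_ge _).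
  by rewrite -addnn leqW // leq_addr.
Qed.

(** Diagonalise: with [g] increasing and [g i] in [Q i], only terms of index below [i] can leave
    [Q i]. If some [Q i] is finite, the empty set does. *)
Lemma pseudo_intersection (Q : nat -> set nat) :
  (forall i, Q i.+1 `<=` Q i) -> exists A : set nat,
  (forall i, finite_set (A `\` Q i)) /\
  ((forall i, ~ finite_set (Q i)) -> ~ finite_set A).
Proof.
move=> Qdec; have [Qinf|Qfin] := pselect (forall i, ~ finite_set (Q i));
    last first.
  exists set0; split=> [i|//]; by rewrite set0D.
have [g [gQ hg]] := increasing_selection Qinf.
have Qle i j : i <= j -> Q j `<=` Q i.
  move=> /subnK <-; elim: (j - i) => // n IH; exact: subset_trans (Qdec _) IH.
exists (range g); split=> [i|_]; last first.
  by apply: infinite_range_ge_id; apply: homo_ltn_ge.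
apply/finite_set_natP; exists (g i) => _ [[j _ <-] nQ].
by apply: hg; rewrite ltnNge; apply/negP => ij; apply: nQ; apply: Qle ij _ _.
Qed.

(** * Columns, positive sets and countable closure *)

Definition col (A : set (nat * nat)) (k : nat) : set nat := [set m | A (k, m)].

Lemma FINxFINP (A : set (nat * nat)) :
  FINxFIN A <-> exists n, forall k, n <= k -> finite_set (col A k).
Proof.
have colE k : xsection A k = col A k.
  by apply/seteqP; split=> m; rewrite /xsection /= inE.
split=> [/finite_set_natP[n H]|[n H]].
  exists n => k nk; apply: contrapT => Ak.
  by have := H k; rewrite /= colE => /(_ Ak); rewrite ltnNge nk.
apply/finite_set_natP; exists n => k /=; rewrite colE => Ak.
by rewrite ltnNge; apply/negP => /H.
Qed.

Lemma FINxFIN_col (A : set (nat * nat)) :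
  (forall k, finite_set (col A k)) -> FINxFIN A.
Proof. by move=> H; apply/FINxFINP; exists 0. Qed.

Definition Positive (A : set (nat * nat)) (A_pos : ~ FINxFIN A) : positive :=
  exist _ A A_pos.

Lemma positive_col (p : positive) (n : nat) :
  exists2 k, n <= k & ~ finite_set (col (sval p) k).
Proof.
apply: contrapT => H; apply: (svalP p); apply/FINxFINP; exists n => k nk.
by apply: contrapT => pk; apply: H; exists k.
Qed.

Lemma positive_le_sub (q p : positive) : sval q `<=` sval p -> positive_le q p.
Proof.
move=> qp; apply: FINxFIN_col => k; apply: sub_finite_set (@finite_set0 _).
by move=> m [/qp].
Qed.

Lemma positiveI (q : positive) (A : set (nat * nat)) :
  FINxFIN (sval q `\` A) -> ~ FINxFIN (sval q `&` A).
Proof.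
move=> qA qIA; apply: (svalP q); apply: FINxFIN_sub (FINxFIN_setU qA qIA).
by move=> x qx; have [Ax|nAx] := pselect (A x); [right|left].
Qed.

(** The intersection [C i] of the first [i.+1] conditions differs from [q i] by a set in the ideal,
    so it has arbitrarily late infinite columns. Column [g i] of the bound is taken from [C i]; from
    that column on, the bound lies inside [q i]. *)
Lemma positive_lower_bound (q : nat -> positive) :
  (forall i, positive_le (q i.+1) (q i)) ->
  exists r, forall i, positive_le r (q i).
Proof.
move=> qdec.
have qle i j : i <= j -> positive_le (q j) (q i).
  move=> /subnK <-; elim: (j - i) => [|n IH]; first exact: positive_le_refl.
  exact: positive_le_trans (qdec _) IH.
pose C i := [set x | forall j, j <= i -> sval (q j) x].
have Cpos i : ~ FINxFIN (C i).
  have qC n : n <= i -> FINxFIN (sval (q i) `\` C n).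
    elim: n => [|n IH] ni.
      apply: FINxFIN_sub (qle 0 i ni) => x [qx nx]; split=> // q0; apply: nx => j.
      by rewrite leqn0 => /eqP->.
    apply: FINxFIN_sub (FINxFIN_setU (IH (ltnW ni)) (qle _ _ ni)) => x [qx nx].
    have [qn|qn] := pselect (sval (q n.+1) x); [left|by right].
    split=> // H; apply: nx => j; rewrite leq_eqVlt => /orP[/eqP->//|].
    exact: H.
  move=> Ci; apply: (positiveI (qC i (leqnn i))).
  by apply: FINxFIN_sub Ci => x [].
pose K i := [set k | ~ finite_set (col (C i) k)].
have Kinf i : ~ finite_set (K i).
  move=> /finite_set_natP[N H]; apply: (Cpos i); apply/FINxFINP.
  by exists N => k Nk; apply: contrapT => /H; rewrite ltnNge Nk.
have [g [gK hg]] := increasing_selection Kinf.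
have rpos : ~ FINxFIN [set x | exists2 i, x.1 = g i & C i x].
  move=> /FINxFINP[n H]; apply: (gK n).
  apply: sub_finite_set (H (g n) (homo_ltn_ge hg n)) => m Cm; by exists n.
exists (Positive rpos) => i; apply/FINxFINP; exists (g i) => k ik.
apply: sub_finite_set (@finite_set0 _) => m [[j /= kE Cj]]; apply; apply: Cj.
rewrite leqNgt; apply/negP => /hg; by rewrite -kE ltnNge ik.
Qed.

(** Countable closure: one condition meets countably many open sets dense below [p]. *)
Lemma positive_dense_sequence (p : positive) (D : nat -> positive -> Prop) :
  (forall i q r, positive_le r q -> D i q -> D i r) ->
  (forall i q, positive_le q p -> exists2 r, positive_le r q & D i r) ->
  exists2 r, positive_le r p & forall i, D i r.
Proof.
move=> Dopen Ddense.
have [f Hf] : {f : nat * positive -> positive & forall x,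
    positive_le x.2 p -> positive_le (f x) x.2 /\ D x.1 (f x)}.
  apply: (@choice _ _ (fun x r =>
    positive_le x.2 p -> positive_le r x.2 /\ D x.1 r)).
  move=> [i q] /=; have [qp|qp] := pselect (positive_le q p); last by exists p.
  by have [r] := Ddense i q qp; exists r.
pose q := fix q i := if i is i'.+1 then f (i', q i') else p.
have qp i : positive_le (q i) p.
  elim: i => [|i IH]; first exact: positive_le_refl.
  exact: positive_le_trans (Hf (i, q i) IH).1 IH.
have [|r Hr] := @positive_lower_bound q.
  by move=> i; exact: (Hf (i, q i) (qp i)).1.
exists r; first exact: Hr 0.
move=> i; apply: Dopen (Hr i.+1) _; exact: (Hf (i, q i) (qp i)).2.
Qed.

(** * Traces and locked columns *)

Lemma FINxFIN_finite_columns (A : set (nat * nat)) (n : nat) :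
  FINxFIN (A `&` [set x | x.1 < n]).
Proof.
apply/FINxFINP; exists n => k nk; apply: sub_finite_set (@finite_set0 _).
by move=> m [_ /=]; rewrite ltnNge nk.
Qed.

(* [M q c] stands for "q forces that the check name of c is in the base". *)
Record base_relation (p0 : positive)
    (M : positive -> set (nat * nat) -> Prop) : Prop := BaseRelation {
  base_mono : forall q r c, positive_le r q -> M q c -> M r c;
  base_setI : forall q c d, M q c -> M q d -> M q (c `&` d);
  base_dense : forall q, positive_le q p0 ->
    exists r c, [/\ positive_le r q, M r c & c `<=` sval q];
  base_limit : forall q c (d : nat -> set (nat * nat)),
    M q c -> (forall i, M q (d i)) ->
    (forall i x, x.1 < i -> x.2 < i -> (d i x <-> c x)) ->
    ~ (forall i k, k < i -> finite_set (col (d i) k)) }.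

(** A trace is coded by a list so that the triples [(F, i, k)] form a countable type, which the
    fusion can enumerate. *)
Definition has_trace (F : seq (nat * nat)) (i : nat) (d : set (nat * nat)) :=
  forall x, x.1 < i -> x.2 < i -> (d x <-> x \in F).

Lemma has_trace_exists (c : set (nat * nat)) (i : nat) :
  exists F, has_trace F i c.
Proof.
exists [seq x <- allpairs pair (iota 0 i) (iota 0 i) | `[< c x >]].
move=> [a b] /= ai bi; rewrite mem_filter; split=> [cx|/andP[/asboolP//]].
apply/andP; split; first exact/asboolP.
by apply/allpairsP; exists (a, b); rewrite !mem_iota.
Qed.

Lemma has_traceI F i c d :
  has_trace F i c -> has_trace F i d -> has_trace F i (c `&` d).
Proof.
move=> Fc Fd x xi yi; split=> [[/Fc->]//|Fx].
by split; [apply/Fc|apply/Fd].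
Qed.

(** Ranging over all [r'] below [r] makes locking pass to stronger conditions. *)
Definition column_locked (M : positive -> set (nat * nat) -> Prop)
    (r : positive) (F : seq (nat * nat)) (i k : nat) : Prop :=
  forall r' d, positive_le r' r -> M r' d -> has_trace F i d ->
    ~ finite_set (col d k).

(** If nothing were locked, members with the trace of [c] could be thinned one column at a time, by
    intersecting with a member whose next column is finite. Collecting such members for every [i]
    under a single condition contradicts [base_limit]. *)
Lemma column_locked_exists p0 M (MB : base_relation p0 M) q c :
  M q c -> exists r F i k,
    [/\ positive_le r q, has_trace F i c & column_locked M r F i k].
Proof.
move=> Mqc; apply: contrapT => nolock.
have thin F i q' : positive_le q' q -> has_trace F i c -> forall n,
    exists r d, [/\ positive_le r q', M r d, has_trace F i d &
      forall k, k < n -> finite_set (col d k)].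
  move=> q'q Fc; elim=> [|n [r [d [rq' Mrd Fd dfin]]]].
    exists q', c; split=> //; [exact: positive_le_refl|].
    exact: base_mono MB _ _ _ q'q Mqc.
  have : ~ column_locked M r F i n.
    move=> H; apply: nolock; exists r, F, i, n; split=> //.
    exact: positive_le_trans rq' q'q.
  move=> /existsNP[r' /existsNP[e H]].
  have {H} [r'r Mr'e Fe efin] : [/\ positive_le r' r, M r' e, has_trace F i e &
      finite_set (col e n)].
    by apply: contrapT => H'; apply: H => *; apply: contra_not H' => *; split.
  exists r', (d `&` e); split.
  - exact: positive_le_trans r'r rq'.
  - by apply: (base_setI MB) => //; exact: base_mono MB _ _ _ r'r Mrd.
  - exact: has_traceI.
  move=> k; rewrite ltnS leq_eqVlt => /orP[/eqP->|kn].
    by apply: sub_finite_set efin => m [].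
  by apply: sub_finite_set (dfin k kn) => m [].
pose D i r := exists d, [/\ M r d,
  forall x, x.1 < i -> x.2 < i -> (d x <-> c x) &
  forall k, k < i -> finite_set (col d k)].
have [i r s sr [d [Mrd dc dfin]]|i q' q'q|r rq Dr] := @positive_dense_sequence q D.
- by exists d; split=> //; exact: base_mono MB _ _ _ sr Mrd.
- have [F Fc] := has_trace_exists c i.
  have [r [d [rq' Mrd Fd dfin]]] := thin F i q' q'q Fc i.
  exists r => //; exists d; split=> // x x1 x2.
  by rewrite (propext (Fd x x1 x2)) (propext (Fc x x1 x2)).
have [d Hd] := choice Dr.
apply: (base_limit MB (q := r) (c := c) (d := d)) => [|i|i|i].
- exact: base_mono MB _ _ _ rq Mqc.
- by case: (Hd i).
- by case: (Hd i).
- by case: (Hd i).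
Qed.

(** * Unlocking columns by fusion *)

(** Split column [k] of [q] into halves [A] and [A']. If below [q] a member with trace [F] has a
    locked column almost inside [A], keep [A']; otherwise keep [A]. The bound [n] protects the
    columns that the fusion has promised to keep infinite. *)
Lemma unlock_column p0 M (MB : base_relation p0 M) (q : positive) (n : nat)
    F (i k : nat) : exists q' : positive, [/\ sval q' `<=` sval q,
  forall l, l < n -> ~ finite_set (col (sval q) l) ->
    ~ finite_set (col (sval q') l) &
  forall r d, positive_le r q' -> M r d -> has_trace F i d ->
    finite_set (col d k `\` col (sval q') k) -> ~ column_locked M r F i k].
Proof.
have [A [A' [AQ A'Q AA' Ainf A'inf]]] := infinite_set_split (col (sval q) k).
(* Restricting a single column leaves all later columns intact, so positivity survives. *)
have keep (E : set nat) (b : set (nat * nat)) : ~ FINxFIN b ->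
    ~ FINxFIN (b `&` [set x | x.1 = k -> E x.2]).
  move=> bpos /FINxFINP[m H]; apply: bpos; apply/FINxFINP.
  exists (maxn m k.+1) => l; rewrite geq_max => /andP[ml kl].
  apply: sub_finite_set (H l ml) => y by_; split=> //= lk.
  by move: kl; rewrite lk ltnn.
have [[r [d [rq Mrd Fd dA]] lock]|none] := pselect (exists2 r, exists d,
    [/\ positive_le r q, M r d, has_trace F i d & finite_set (col d k `\` A)]
    & column_locked M r F i k).
  (* Pass to [r], intersected with [q] because [r] is below [q] only modulo the ideal; then restore
     [q] before column [n], which affects only finitely many columns. *)
  pose b := (sval r `&` sval q) `|` (sval q `&` [set x | x.1 < n]).
  have bpos : ~ FINxFIN b.
    by move=> Hb; apply: (positiveI rq); apply: FINxFIN_sub Hb => x; left.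
  exists (Positive (keep A' b bpos)); split=> [x [[[]|[]]]//|l ln linf|].
    move=> H; have [lk|lk] := eqVneq l k.
      apply: A'inf; first by rewrite -lk.
      apply: sub_finite_set H => y Ay; split=> //; right; split=> //.
      by rewrite lk; exact: A'Q.
    apply: linf; apply: sub_finite_set H => y qy; split; first by right.
    by move=> /= lk'; rewrite lk' eqxx in lk.
  move=> r' d' r'q' Mr'd' Fd' d'fin lock'.
  have r'r : positive_le r' r.
    apply: FINxFIN_sub (FINxFIN_setU r'q' (FINxFIN_finite_columns setT n)).
    move=> x [r'x nrx].
    have [xn|xn] := pselect (x.1 < n); [by right|left].
    by split=> // -[[[]|[]]].
  (* The intersection is a member with the same trace, so its column [k] should be infinite; but it
     is almost inside both disjoint halves. *)
  apply: (lock' r' (d `&` d') (positive_le_refl _)).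
  - by apply: (base_setI MB) => //; exact: base_mono MB _ _ _ r'r Mrd.
  - exact: has_traceI.
  have : finite_set ((col d k `\` A) `|`
      (col d' k `\` col (sval (Positive (keep A' b bpos))) k)).
    by rewrite finite_setU.
  apply: sub_finite_set => y [dy d'y].
  have [Ay|nAy] := pselect (A y); [right|by left].
  split=> // -[_ /(_ erefl) A'y].
  by have : (A `&` A') y by []; rewrite AA'.
exists (Positive (keep A _ (svalP q))); split=> [x []//|l ln linf H|].
  have [lk|lk] := eqVneq l k.
    apply: Ainf; first by rewrite -lk.
    apply: sub_finite_set H => y Ay; split=> //.
    by rewrite lk; exact: AQ.
  apply: linf; apply: sub_finite_set H => y qy; split=> //.
  by move=> /= lk'; rewrite lk' eqxx in lk.
move=> r d rq' Mrd Fd dfin lock; apply: none; exists r => //; exists d; split=> //.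
  by apply: positive_le_trans rq' _; apply: positive_le_sub => x [].
apply: sub_finite_set dfin => y [dy nAy]; split=> // -[_ /(_ erefl)].
exact: nAy.
Qed.

(** Stage [j] treats the triple coded by [j] and promises one new infinite column between [n j] and
    [n j.+1], which all later stages preserve. *)
Lemma unlock_all_columns p0 M (MB : base_relation p0 M) :
  exists2 q, positive_le q p0 & forall r d F i k, positive_le r q -> M r d ->
    d `<=` sval q -> has_trace F i d -> ~ column_locked M r F i k.
Proof.
pose T := (seq (nat * nat) * nat * nat)%type.
(* Numbers that code no triple get a default one, so every stage has a task. *)
pose task j : T := odflt ([::], 0, 0) (unpickle j).
have [f Hf] : {f : nat * (positive * nat) -> positive * nat & forall x,
    let: (F, i, k) := task x.1 in let: (q, n) := x.2 in let: (q', n') := f x in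
    [/\ sval q' `<=` sval q,
      forall l, l < n -> ~ finite_set (col (sval q) l) ->
        ~ finite_set (col (sval q') l),
      forall r d, positive_le r q' -> M r d -> has_trace F i d ->
        finite_set (col d k `\` col (sval q') k) -> ~ column_locked M r F i k &
      exists l, [/\ n <= l, l < n' & ~ finite_set (col (sval q') l)]]}.
  apply: (@choice _ _ (fun x y =>
    let: (F, i, k) := task x.1 in let: (q, n) := x.2 in let: (q', n') := y in _)).
  move=> [j [q n]] /=; case: (task j) => [[F i] k].
  have [q' [q'q q'inf q'lock]] := unlock_column MB q n F i k.
  have [l nl linf] := positive_col q' n.
  by exists (q', l.+1); split=> //; exists l.
pose s := fix s j := if j is j'.+1 then f (j', s j') else (p0, 0).
pose q j := (s j).1; pose n j := (s j).2.
have step j : let: (F, i, k) := task j in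
    [/\ sval (q j.+1) `<=` sval (q j),
      forall l, l < n j -> ~ finite_set (col (sval (q j)) l) ->
        ~ finite_set (col (sval (q j.+1)) l),
      forall r d, positive_le r (q j.+1) -> M r d -> has_trace F i d ->
        finite_set (col d k `\` col (sval (q j.+1)) k) ->
        ~ column_locked M r F i k &
      exists l, [/\ n j <= l, l < n j.+1 & ~ finite_set (col (sval (q j.+1)) l)]].
  have := Hf (j, s j); rewrite /q /n /=; case: (task j) => [[F i] k].
  by case: (s j) => a b; case: (f _).
have qdec j : sval (q j.+1) `<=` sval (q j).
  by have := step j; case: (task j) => [[? ?] ?] [].
have qinf j l : l < n j -> ~ finite_set (col (sval (q j)) l) ->
    ~ finite_set (col (sval (q j.+1)) l).
  by have := step j; case: (task j) => [[? ?] ?] [_ + _ _]; exact.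
have qcol j : exists l, [/\ n j <= l, l < n j.+1 &
    ~ finite_set (col (sval (q j.+1)) l)].
  by have := step j; case: (task j) => [[? ?] ?] [].
have qle i j : i <= j -> sval (q j) `<=` sval (q i).
  by move=> /subnK <-; elim: (j - i) => // m IH; exact: subset_trans (qdec _) IH.
have nS j : n j < n j.+1 by have [l [nl ln _]] := qcol j; exact: leq_ltn_trans ln.
have nle : {homo n : i j / i < j} by apply: homo_ltn => // ? ? ?; exact: ltn_trans.
(* The stages decrease by genuine inclusion, so the fusion can take a pseudo-intersection in each
   column. *)
have [P HP] := choice (fun k => pseudo_intersection
  (Q := fun j => col (sval (q j)) k) (fun j y => @qdec j (k, y))).
have rpos : ~ FINxFIN [set x | P x.1 x.2].
  move=> /FINxFINP[N H]; have [l [Nl ln linf]] := qcol N.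
  have lN : N <= l := leq_trans (homo_ltn_ge nle N) Nl.
  (* Column [l] is infinite at stage [N.+1], hence earlier by inclusion; later stages preserve it
     because [l] lies below [n N.+1]. *)
  apply: (HP l).2 (H l lN) => j.
  have [jN|Nj] := leqP j N.+1.
    by apply: contra_not linf; apply: sub_finite_set => y; exact: qle.
  rewrite -(subnK (ltnW Nj)); elim: (j - N.+1) => // m IH.
  apply: qinf IH; apply: leq_trans ln _.
  case: m => // m; apply: ltnW; apply: nle; by rewrite -[X in X < _]add0n ltn_add2r.
have rq j : positive_le (Positive rpos) (q j).
  by apply: FINxFIN_col => k; exact: (HP k).1.
exists (Positive rpos) => [|r d F i k rr Mrd dr Fd]; first exact: rq 0.
(* A column inside the fusion is almost inside that of the stage which treated this very triple. *)
have := step (pickle ((F, i, k) : T)); rewrite /task pickleK /=.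
move=> [_ _ H _]; apply: H Mrd Fd _.
  exact: positive_le_trans rr (rq _).
apply: sub_finite_set ((HP k).1 (pickle ((F, i, k) : T)).+1) => y [dy nqy].
by split; [exact: (dr (k, y) dy)|exact: nqy].
Qed.

Lemma base_relation_false p0 M : ~ base_relation p0 M.
Proof.
move=> MB; have [q qp0 unlocked] := unlock_all_columns MB.
have [r [c [rq Mrc cq]]] := base_dense MB qp0.
have [s [F [i [k [sr Fc lock]]]]] := column_locked_exists MB Mrc.
apply: (unlocked s c F i k _ _ cq Fc lock); first exact: positive_le_trans sr rq.
exact: base_mono MB _ _ _ sr Mrc.
Qed.

(** * From names to ground-model sets *)

Lemma forces_mem_mono (P : forcing_notion) (S : Type) (p q : P) (s : S) tau :
  fle q p -> forces_mem p s tau -> forces_mem q s tau.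
Proof. by move=> qp H r rq; apply: H; exact: fle_trans qp. Qed.

Lemma forces_in_mono (P : forcing_notion) (S : Type) (p q : P)
    (sigma : subset_name P S) B :
  fle q p -> forces_in p sigma B -> forces_in q sigma B.
Proof. by move=> qp H r rq; apply: H; exact: fle_trans qp. Qed.

Lemma forces_mem_check (P : forcing_notion) (S : Type) (p : P) (s : S)
    (A : set S) : forces_mem p s (check A) <-> A s.
Proof.
split=> [/(_ p (fle_refl p))[q _ [r []]]//|As q qp].
by exists q; [exact: fle_refl|exists q; split=> //; exact: fle_refl].
Qed.

Lemma forces_mem_comprehension (P : forcing_notion) (S : Type) (p : P) (s : S)
    (phi : S -> formula P) :
  (forall q r, fle r q -> forces q (phi s) -> forces r (phi s)) ->
  forces_mem p s (comprehension phi) <->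
    dense_below p [set q | forces q (phi s)].
Proof.
move=> mono; split=> H q qp; have [r rq] := H q qp.
  by move=> [t [/= Ht rt]]; exists r => //; exact: mono rt Ht.
by move=> Hr; exists r => //; exists r; split=> //; exact: fle_refl.
Qed.

Lemma forces_eq_in (P : forcing_notion) (S : Type) (p : P)
    (sigma tau : subset_name P S) B :
  forces_eq p sigma tau -> forces_in p sigma B -> forces_in p tau B.
Proof.
move=> E H q qp; have [r rq [rho [t [Bt rt Er]]]] := H q qp.
exists r => //; exists rho, t; split=> // s u ur.
have up : fle u p by exact: fle_trans ur (fle_trans rq qp).
by rewrite -(propext (Er s u ur)) (propext (E s u up)).
Qed.

Lemma forces_eq_cap_check (P : forcing_notion) (S : Type) (p : P)
    (A B : set S) :
  forces_eq p (cap_name (check A) (check B)) (check (A `&` B)).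
Proof.
move=> s q qp; rewrite forces_mem_check forces_mem_comprehension; last first.
  by move=> u v vu /= [HA HB]; split; exact: forces_mem_mono vu _.
split=> [/(_ q (fle_refl q))[r _ [/forces_mem_check As /forces_mem_check Bs]]//|].
move=> [As Bs] r rq; exists r; first exact: fle_refl.
by split; apply/forces_mem_check.
Qed.

(** No new subset of a countable set appears: deciding one pair is an open dense task, and there are
    countably many pairs. *)
Lemma decide_name (p : FINxFIN_positive)
    (tau : subset_name FINxFIN_positive (nat * nat)) :
  exists2 r, fle r p & exists c, forces_eq r tau (check c).
Proof.
pose D (j : nat) (r : FINxFIN_positive) := forall s : nat * nat,
  unpickle j = Some s ->
  forces_mem r s tau \/ forall r', fle r' r -> ~ forces_mem r' s tau.
have [j q r rq Dq s js|j q qp|r rp Dr] := @positive_dense_sequence p D.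
- case: (Dq s js) => H; [left|right=> r' r'r].
    exact: (forces_mem_mono (p := q : FINxFIN_positive)) H.
  by apply: H; exact: positive_le_trans rq.
- case js: (unpickle j : option (nat * nat)) => [s|]; last first.
    by exists q; [exact: positive_le_refl|move=> s; rewrite js].
  have [[r rq Hr]|H] := pselect (exists2 r : FINxFIN_positive,
    fle r q & forces_mem r s tau).
    by exists r => // s'; rewrite js => -[<-]; left.
  exists q; first exact: positive_le_refl.
  move=> s'; rewrite js => -[<-]; right=> r rq Hr; apply: H; by exists r.
exists r => //; exists [set s | forces_mem (r : FINxFIN_positive) s tau] => s q qr.
rewrite forces_mem_check; split=> [Hq|Hr]; last exact: forces_mem_mono qr Hr.
by case: (Dr (pickle s) s (pickleK s)) => // /(_ q qr).
Qed.

Lemma forces_generic_self (p : FINxFIN_positive) :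
  forces_in p (check (sval p)) generic_name.
Proof.
move=> q qp; exists q; first exact: fle_refl.
by exists (check (sval p)), p; split.
Qed.

Lemma forces_in_generic (p : FINxFIN_positive)
    (sigma : subset_name FINxFIN_positive (nat * nat)) :
  forces_in p sigma generic_name ->
  exists r t : FINxFIN_positive, fle r p /\
    forces_eq r sigma (check (sval t)).
Proof.
move=> /(_ p (fle_refl p))[r rp [tau [t [tauE _ E]]]].
by exists r, t; split=> //; rewrite -[check _]tauE.
Qed.

(** Restricting to check names keeps density, since [decide_name] turns a member of the base into a
    ground-model set. For the limit clause, an infinite intersection in the generic ultrafilter
    would equal a positive set [t] all of whose columns are finite. *)
Lemma base_relation_of_name (p : FINxFIN_positive)
    (B : family_name FINxFIN_positive (nat * nat)) :
  forces p (filter_base_formula B generic_name) ->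
  forces p (All (fun b : seq_name FINxFIN_positive (nat * nat) =>
    All (fun c : subset_name FINxFIN_positive (nat * nat) =>
      Imp (And (All (fun n : nat => In (b n) B))
               (And (In c B) (converges_formula b c)))
          (Ex (fun X : subset_name FINxFIN_positive nat =>
             And (infinite_formula X) (In (bigcap_name X b) generic_name)))))) ->
  base_relation p (fun q c => positive_le q p /\
    forces_in (q : FINxFIN_positive) (check c) B).
Proof.
move=> /= [_ [Bbase Bcap]] Blim; split.
- move=> q r c rq [qp H]; split; first exact: positive_le_trans rq qp.
  exact: (forces_in_mono (p := q : FINxFIN_positive)) rq H.
- move=> q c d [qp Hc] [_ Hd]; split=> //.
  exact: forces_eq_in (@forces_eq_cap_check _ _ _ c d) (Bcap _ _ q qp (conj Hc Hd)).
- move=> q qp.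
  (* [q] forces its own check name into the generic ultrafilter, so the base has a member inside
     [q]. *)
  have [r rq [b [Hb bq]]] := Bbase _ q qp (@forces_generic_self q) q (positive_le_refl q).
  have [s sr [c Ec]] := decide_name r b.
  exists s, c; split; first exact: positive_le_trans sr rq.
    split; first exact: positive_le_trans (positive_le_trans sr rq) qp.
    exact: forces_eq_in Ec (forces_in_mono sr Hb).
  move=> x cx; apply/(forces_mem_check (s : FINxFIN_positive)); apply: bq => //.
  by apply/(Ec x s (fle_refl s)); apply/forces_mem_check.
move=> q c d [qp Hc] Hd agree dfin.
have conv : forces (q : FINxFIN_positive)
    (converges_formula (fun i => check (d i)) (check c)).
  move=> F r rq; exists r; first exact: fle_refl.
  (* From this bound on, the square [n] by [n] contains [F], and [d n] agrees with [c] there. *)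
  exists (maxn (\max_(x <- F) x.1) (\max_(x <- F) x.2)).+1 => n r1 _ nN x r2 _ xF.
  have [x1 x2] : x.1 < n /\ x.2 < n.
    split; apply: leq_trans nN; rewrite ltnS leq_max.
      by rewrite (leq_bigmax_seq x (F := fst)).
    by rewrite (leq_bigmax_seq x (F := snd)) ?orbT.
  by split=> r3 _ /forces_mem_check H; apply/forces_mem_check; apply/(agree n x x1 x2).
have [r rq [X [Xinf HX]]] := Blim _ _ q qp
  (conj (fun i => (Hd i).2) (conj Hc conv)) q (positive_le_refl q).
have [s [t [sr Et]]] := forces_in_generic HX.
(* A condition putting [n] into [X] forces the intersection into [d n]; membership in check names is
   absolute, so [t] really is a subset of [d n]. *)
have tsub x n s' : sval t x -> fle s' s -> forces_mem s' n X -> d n x.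
  move=> tx s's Hn.
  have : forces_mem s x (bigcap_name X (fun i => check (d i))).
    by apply/(Et x s (fle_refl s)); apply/forces_mem_check.
  rewrite forces_mem_comprehension; last first.
    move=> u v vu /= H m w wv; apply: H; exact: fle_trans vu.
  move=> /(_ s' s's)[u us' /(_ n u (fle_refl u))].
  by move=> /(_ (forces_mem_mono us' Hn)) /forces_mem_check.
apply: (svalP t); apply: FINxFIN_col => k.
(* An index above [k] is forced into [X], so column [k] of [t] lies in a finite column of that
   [d n]. *)
have [s' s's [n [/= kn Hn]]] := Xinf k.+1 s sr.
apply: sub_finite_set (dfin n k kn) => y ty; exact: tsub ty s's Hn.
Qed.

Theorem theorem10 :
  forced (P := FINxFIN_positive) (Not (basically_generated generic_name)).
Proof.
move=> p q _ /(_ q (fle_refl q))[r _ [B [Bbase Blim]]].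
exact: base_relation_false (base_relation_of_name Bbase Blim).
Qed.
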